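(* Let $\Omega$ be a nonempty open subset of $\mathbb{C}$. Then the set $\mathcal{S}_{uc} \setminus \mathcal{S}_{u}$ is pointwise spaceable in $H(\Omega)^{\mathbb{N}}$; that is, for every $\mathbf{f} \in \mathcal{S}_{uc} \setminus \mathcal{S}_{u}$ there exists a closed infinite dimensional vector subspace $M_{\mathbf{f}}$ of $H(\Omega)^{\mathbb{N}}$ such that $\mathbf{f} \in M_{\mathbf{f}} \subset (\mathcal{S}_{uc} \setminus \mathcal{S}_{u}) \cup \{0\}$.
   Context: $\mathbb{N}=\{1,2,3,\dots\}$. $H(\Omega)$ is the complex vector space of all holomorphic functions on $\Omega$ (not assumed connected), endowed with the topology of uniform convergence on compact subsets of $\Omega$. $H(\Omega)^{\mathbb{N}}$ is the vector space of all sequences $(f_n)_{n\in\mathbb{N}}$ in $H(\Omega)$ with coordinatewise operations, endowed with the product topology. Define $\mathcal{S}_{uc} = \{(f_n)\in H(\Omega)^{\mathbb{N}} : f_n \to 0 \text{ uniformly on each compact subset of } \Omega\}$ and $\mathcal{S}_{u} = \{(f_n)\in H(\Omega)^{\mathbb{N}} : f_n \to 0 \text{ uniformly on } \Omega\}$. A subset $A$ of a topological vector space $X$ is called pointwise spaceable if for every $x\in A$ there exists a closed infinite dimensional vector subspace $M_x\subset X$ such that $x\in M_x\subset A\cup\{0\}$. *)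

(* Defs.v *)
From HB Require Import structures.
From mathcomp Require Import all_boot all_order all_algebra.
From mathcomp Require Import all_classical all_reals all_analysis.
From mathcomp Require Import complex.

Set Implicit Arguments.
Unset Strict Implicit.
Unset Printing Implicit Defensive.

Import Order.TTheory GRing.Theory Num.Theory.
Import numFieldNormedType.Exports.

Local Open Scope classical_set_scope.
Local Open Scope complex_scope.
Local Open Scope ring_scope.

(* The library topologizes an abstract numFieldType by its norm; this gives
   the concrete type R[i] the same structure, as a normed space over itself. *)
HB.instance Definition _ (R : realType) :=
  NormedModule.copy R[i] (R[i] : numClosedFieldType)^o.

Section Spaceability.
Context {K : numFieldType}.

(* M, meant to be a linear subspace, is spanned by finitely many vectors. *)
Definition finite_dim (X : lmodType K) (M : set X) : Prop :=
  exists (n : nat) (v : 'I_n -> X), (forall i, M (v i)) /\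
    forall x, M x -> exists c : 'I_n -> K, x = \sum_(i < n) c i *: v i.

Definition pointwise_spaceable (X : topologicalLmodType K) (A : set X) : Prop :=
  forall x, A x -> exists M : set X,
    [/\ submod_closed [in M], closed M, ~ finite_dim M, M x
      & M `<=` A `|` [set 0]].

End Spaceability.

Section ExtensionByZero.
Context {T : Type} {K : pzRingType} {V : lmodType K} (A : set T).

Lemma valL0 : 'valL_0 (0 : A -> V) = 0.
Proof. by apply/funext => w /=; case: ('oinv_set_val w). Qed.

Lemma valLZD (a : K) (f g : A -> V) :
  'valL_0 (a *: f + g) = a *: 'valL_0 f + 'valL_0 g.
Proof.
apply/funext => w.
rewrite [LHS]/= [RHS]/(_ *: 'valL_0 f w + 'valL_0 g w) /=.
by case: ('oinv_set_val w) => [x|] //; rewrite -[RHS]/(a *: 0 + 0)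
  scaler0 addr0.
Qed.

End ExtensionByZero.

Section HolomorphicFunctions.
Context {R : realType}.
Implicit Types Omega : set R[i].

(* f is defined on Omega only; 'valL_0 f extends it by 0 to the whole plane.
   For open Omega, complex differentiability at a point of Omega does not
   depend on how f is extended. *)
Definition holomorphic Omega (f : Omega -> R[i]) : Prop :=
  forall z : Omega, derivable ('valL_0 f) (val z) 1.

Definition holomorphic_pred Omega : {pred Omega -> R[i]} :=
  mem [set f | holomorphic f].

Lemma holomorphic_submod_closed Omega : submod_closed (@holomorphic_pred Omega).
Proof.
split=> [|a f g /set_mem hf /set_mem hg]; apply/mem_set => z.
  by rewrite valL0; exact: derivable_cst.
rewrite valLZD.
by apply: derivableD; [apply: derivableZ; exact: hf|exact: hg].
Qed.

HB.instance Definition _ Omega := GRing.isSubmodClosed.Build _ _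
  (@holomorphic_pred Omega) (@holomorphic_submod_closed Omega).

Record holFun Omega := HolFun {
  holval :> Omega -> R[i];
  holvalP : holval \in @holomorphic_pred Omega }.

HB.instance Definition _ Omega := [isSub for @holval Omega].
HB.instance Definition _ Omega := [Choice of holFun Omega by <:].
HB.instance Definition _ Omega :=
  [SubChoice_isSubLmodule of holFun Omega by <:].

(* topology of uniform convergence on the compact subsets of Omega *)
HB.instance Definition _ Omega := Uniform.copy (holFun Omega)
  (initial_topology
    (@holval Omega : holFun Omega -> {family compact, Omega -> R[i]})).

Lemma cvg_holP Omega (F : set_system (holFun Omega)) (f : holFun Omega) :
  Filter F ->
  F --> f <-> forall K : set Omega, compact K -> forall e : R[i], 0 < e ->
    F [set g : holFun Omega | forall z, K z -> `|f z - g z| < e].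
Proof.
move=> FF; split=> [Ff K cK e e0|Ff].
  have Ffam : {family compact, (@holval Omega) @ F --> (f : Omega -> R[i])}.
    apply: cvg_trans; last exact: (@initial_continuous _ _
      (@holval Omega : holFun Omega -> {family compact, Omega -> R[i]}) f).
    exact: cvg_app.
  move/fam_cvgP : Ffam => /(_ K cK)
    /(_ [set g : Omega -> R[i] | forall z, K z -> `|f z - g z| < e]); apply.
  apply/uniform_nbhs; exists [set xy | ball xy.1 e xy.2]; split.
    exact: entourage_ball (PosNum e0).
  by move=> g /= Kg z /Kg; rewrite -ball_normE.
have Ffam : {family compact, (@holval Omega) @ F --> (f : Omega -> R[i])}.
  apply/fam_cvgP => K cK P /uniform_nbhs[E [entE EP]].
  move: entE; rewrite -entourage_ballE => -[e /= e0 eE].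
  have := Ff K cK e e0; apply: filterS => g Kg.
  apply: EP => z Kz; apply: eE => /=; rewrite -ball_normE; exact: Kg.
move=> A [_ [[B oB <-] Bf BA]]; apply: filterS BA _.
by apply: Ffam; exact: open_nbhs_nbhs.
Qed.

Lemma nbhs_holFun Omega (f : holFun Omega) (K : set Omega) (e : R[i]) :
  compact K -> 0 < e ->
  nbhs f [set g : holFun Omega | forall z, K z -> `|f z - g z| < e].
Proof.
move=> cK e0; have /(cvg_holP f)/(_ K cK e e0) // : nbhs f --> f.
exact: cvg_id.
Qed.

Lemma holFun_continuous Omega (f : holFun Omega) :
  continuous (f : Omega -> R[i]).
Proof.
move=> z; have /set_mem/(_ z)/derivable1_diffP/differentiable_continuous fz :=
  holvalP f.
have fE : (f : Omega -> R[i]) = 'valL_0 f \o set_val.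
  by rewrite -[LHS](valLK 0).
suff : {for z, continuous ('valL_0 f \o set_val)} by rewrite -fE.
apply: (@continuous_comp Omega R[i] R[i] set_val ('valL_0 f) z).
  exact: (@initial_continuous Omega R[i] set_val).
exact: fz.
Qed.

Lemma holFun_bounded Omega (f : holFun Omega) (K : set Omega) : compact K ->
  exists2 M : R[i], 0 < M & forall z, K z -> `|f z| < M.
Proof.
move=> /compact_near_coveringP cK.
have [|n _ nP] := cK nat \oo (fun n z => `|f z| < n%:R) _.
  move=> z _; have [n zn] : exists n, `|f z| + 1 < n%:R :> R[i].
    exists (Num.truncn (complex.Re (`|f z| + 1))).+1.
    rewrite -[ltLHS]RRe_real ?ger0_real ?addr_ge0//.
    by rewrite -(rmorph_nat (real_complex R)) ltcR truncnS_gt.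
  have f1 : nbhs z [set z' | `|f z - f z'| < 1].
    apply: (holFun_continuous (f := f) (x := z)
      (_ : nbhs (f z) [set w | `|f z - w| < 1])).
    by apply/nbhs_ballP; exists 1 => //= w; rewrite -ball_normE.
  exists ([set z' | `|f z - f z'| < 1], [set m | (n <= m)%N]).
    by split => //; exists n.
  move=> [z' m] [/= zz' nm]; rewrite distrC in zz'.
  apply: (@lt_le_trans _ _ n%:R); last by rewrite ler_nat.
  apply: (lt_trans _ zn).
  have -> : f z' = f z + (f z' - f z) by rewrite addrC subrK.
  by rewrite (le_lt_trans (ler_normD _ _))// ltrD2l.
exists n.+1%:R => // z Kz; exact: (nP n.+1 (leqnSn n)).
Qed.

Lemma holFun_add_continuous Omega :
  continuous (fun x : holFun Omega * holFun Omega => x.1 + x.2).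
Proof.
move=> [f g]; apply/cvg_holP => K cK e e0.
have e2 : 0 < e / 2 by rewrite divr_gt0.
exists ([set f' : holFun Omega | forall z, K z -> `|f z - f' z| < e / 2],
  [set g' : holFun Omega | forall z, K z -> `|g z - g' z| < e / 2]).
  by split; exact: nbhs_holFun.
move=> [f' g'] [/= ff' gg'] z Kz.
rewrite -[X in `|X|]/(f z + g z - (f' z + g' z)) opprD addrACA.
rewrite (splitr e) (le_lt_trans (ler_normD _ _))// ltrD//.
  exact: ff'.
exact: gg'.
Qed.

Lemma holFun_scale_continuous Omega :
  continuous (fun x : R[i]^o * holFun Omega => x.1 *: x.2).
Proof.
move=> [a f]; apply/cvg_holP => K cK e e0.
have [M M0 fM] := holFun_bounded f cK.
have d0 : 0 < e / 2 / M by rewrite !divr_gt0.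
have a1 : 0 < `|a| + 1 by rewrite ltr_wpDl.
have c0 : 0 < e / 2 / (`|a| + 1) by rewrite !divr_gt0.
exists (ball (a : R[i]^o) 1 `&` ball (a : R[i]^o) (e / 2 / M),
  [set g : holFun Omega |
    forall z, K z -> `|f z - g z| < e / 2 / (`|a| + 1)]) => /=.
  by split; [apply: filterI; exact: nbhsx_ballx|exact: nbhs_holFun].
move=> [b g] [/= [+ +] fg] z Kz; rewrite -ball_normE /= => ab1 abM.
rewrite -[X in `|X|]/(a * f z - b * g z).
have -> : a * f z - b * g z = (a - b) * f z + b * (f z - g z).
  by rewrite mulrBl mulrBr addrA subrK.
rewrite (splitr e) (le_lt_trans (ler_normD _ _))// !normrM ltr_leD//.
  rewrite -[ltRHS](divfK (lt0r_neq0 M0)).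
  by rewrite ltr_pM// fM.
rewrite -[leRHS](divfK (lt0r_neq0 a1)) mulrC ler_pM//; first exact/ltW/fg.
rewrite -[b in `|b|](subrK a) addrC (le_trans (ler_normD _ _))// lerD2l.
by rewrite distrC ltW.
Qed.

HB.instance Definition _ Omega :=
  PreTopologicalNmodule_isTopologicalNmodule.Build (holFun Omega)
    (@holFun_add_continuous Omega).
HB.instance Definition _ Omega :=
  TopologicalNmodule_isTopologicalLmodule.Build R[i] (holFun Omega)
    (@holFun_scale_continuous Omega).

(* sequences are indexed from 0; the topology is the product topology *)
Definition holSeq Omega : Type := nat -> holFun Omega.

HB.instance Definition _ Omega :=
  Uniform.copy (holSeq Omega) {ptws nat -> holFun Omega}.
HB.instance Definition _ Omega :=
  GRing.Lmodule.copy (holSeq Omega) (nat -> holFun Omega).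

Lemma cvg_holSeqP Omega (F : set_system (holSeq Omega)) (u : holSeq Omega) :
  Filter F -> F --> u <-> forall n, (fun v : holSeq Omega => v n) @ F --> u n.
Proof. by move=> FF; apply: pointwise_cvgP. Qed.

Lemma holSeq_proj_continuous Omega n :
  continuous (fun u : holSeq Omega => u n).
Proof.
by move=> u; have /(cvg_holSeqP u)/(_ n) : nbhs u --> u by exact: cvg_id.
Qed.

Lemma holSeq_add_continuous Omega :
  continuous (fun x : holSeq Omega * holSeq Omega => x.1 + x.2).
Proof.
move=> [u v]; apply/cvg_holSeqP => n.
have un : (x.1 : holSeq Omega) n @[x --> (u, v)] --> u n.
  apply: (@cvg_comp _ _ _ fst (fun w : holSeq Omega => w n) _ (nbhs u)).
    exact: cvg_fst.
  exact: holSeq_proj_continuous.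
have vn : (x.2 : holSeq Omega) n @[x --> (u, v)] --> v n.
  apply: (@cvg_comp _ _ _ snd (fun w : holSeq Omega => w n) _ (nbhs v)).
    exact: cvg_snd.
  exact: holSeq_proj_continuous.
exact: (cvg_comp _ _ (cvg_pair un vn)
  (@add_continuous (holFun Omega) (u n, v n))).
Qed.

Lemma holSeq_scale_continuous Omega :
  continuous (fun x : R[i]^o * holSeq Omega => x.1 *: x.2).
Proof.
move=> [a u]; apply/cvg_holSeqP => n.
have un : (x.2 : holSeq Omega) n @[x --> (a : R[i]^o, u)] --> u n.
  apply: (@cvg_comp _ _ _ snd (fun w : holSeq Omega => w n) _ (nbhs u)).
    exact: cvg_snd.
  exact: holSeq_proj_continuous.
exact: (cvg_comp _ _ (cvg_pair cvg_fst un)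
  (@scale_continuous R[i] (holFun Omega) (a, u n))).
Qed.

HB.instance Definition _ Omega :=
  PreTopologicalNmodule_isTopologicalNmodule.Build (holSeq Omega)
    (@holSeq_add_continuous Omega).
HB.instance Definition _ Omega :=
  TopologicalNmodule_isTopologicalLmodule.Build R[i] (holSeq Omega)
    (@holSeq_scale_continuous Omega).

(* uniform convergence to 0 on each compact subset of Omega, resp. on Omega *)
Definition S_uc Omega : set (holSeq Omega) :=
  [set u | forall K : set Omega, compact K ->
    {uniform K, (fun n => holval (u n)) @ \oo --> (fun=> 0)}].

Definition S_u Omega : set (holSeq Omega) :=
  [set u | {uniform, (fun n => holval (u n)) @ \oo --> (fun=> 0)}].

End HolomorphicFunctions.

Arguments S_uc {R} Omega _.
Arguments S_u {R} Omega _.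

(* Main.v *)
Require Import Defs.
From HB Require Import structures.
From mathcomp Require Import all_boot all_order all_algebra.
From mathcomp Require Import all_classical all_reals all_analysis.
From mathcomp Require Import complex.
From mathcomp Require Import ring.

(* Fix z0 in Omega, a closed disc of radius r around z0 inside Omega, and let E
   be the closed span in H(Omega) of the lacunary powers (z - z0)^(16^k).
   If w_k is a 16^k-th root of -1 close to 1, the difference p(b) - p(b w_k) of a
   lacunary polynomial p kills all terms of index > k, doubles the k-th one, and
   nearly kills the lower ones; hence |c_k| |b|^(16^k) is controlled by p on the
   sequence b w_k -> b alone. Taking b slightly further from z0 than a given z,
   this shows that an element of E is determined by its values at the countably
   many points z0 + r, z0 + r w_k, although Omega need not be connected and
   although it need not contain the circle through b.
   Given f in S_uc \ S_u, some d > 0 satisfies sup |f_n| >= d for infinitely many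
   ("bad") n. Distribute those points and z0 over the indices, as P_n, so that
   each one is used at infinitely many bad n. The subspace consists of the
   sequences whose 0-th term is lam f_0 + phi and whose n-th term is
   (lam + phi(P_n)) f_n, with lam a scalar and phi in E: it is closed because the
   0-th term retains phi (and lam is read off at one bad n with P_n = z0), it
   stays in S_uc because phi is bounded on the relatively compact set of the P_n,
   and if the sequence is in S_u then lam + phi vanishes at all the P_n, so
   lam = - phi(z0) = 0 and phi = 0. *)

Set Implicit Arguments.
Unset Strict Implicit.
Unset Printing Implicit Defensive.

Import Order.TTheory GRing.Theory Num.Theory.
Import numFieldNormedType.Exports.

Local Open Scope classical_set_scope.
Local Open Scope complex_scope.
Local Open Scope ring_scope.

(** * Roots of -1 of order 16^k that tend to 1 *)

Lemma sqrt_near1 (C : numClosedFieldType) (x : C) : `|x| = 1 ->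
  exists2 y, y ^+ 2 = x & `|1 - y| ^+ 2 *+ 2 <= `|1 - x| ^+ 2.
Proof.
move=> x1.
(* Since 1 - y^2 = (1 - y)(1 + y), a root with |1 + y|^2 >= 2 suffices; by the parallelogram law
   [par], one of the two square roots has this property. *)
suff [y yx y2] : exists2 y, y ^+ 2 = x & 2 <= `|1 + y| ^+ 2.
  exists y => //; rewrite -yx (_ : 1 - y ^+ 2 = (1 - y) * (1 + y)); last by ring.
  by rewrite normrM exprMn -mulr_natr ler_wpM2l// exprn_ge0.
have s1 : `|sqrtC x| = 1.
  by apply/eqP; rewrite -(@eqrXn2 _ 2)// -normrX sqrtCK x1 expr1n.
have par : `|1 + sqrtC x| ^+ 2 + `|1 - sqrtC x| ^+ 2 = 4.
  rewrite normCK [`|1 - _| ^+ 2]normCK !rmorphD rmorphN rmorph1.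
  transitivity (2 + 2 * (sqrtC x * (sqrtC x)^*)); first by ring.
  by rewrite -normCK s1; ring.
have sr : `|1 + sqrtC x| ^+ 2 \is Num.real by rewrite ger0_real ?exprn_ge0.
have [le2|lt2] := real_leP (realn C 2) sr; first by exists (sqrtC x); rewrite ?sqrtCK.
exists (- sqrtC x); first by rewrite sqrrN sqrtCK.
rewrite -(lerD2l (`|1 + sqrtC x| ^+ 2)) par.
by rewrite (_ : 4 = 2 + 2) ?lerD2r ?ltW//; ring.
Qed.

(** Four such square roots in a row divide the squared distance to 1 by at least 16. The resulting
    ratio 1/4 makes the error series in [lacunary_coef_le] sum to less than 1. *)
Lemma root16_near1 (C : numClosedFieldType) (x : C) : `|x| = 1 ->
  exists2 y, y ^+ 16 = x & `|1 - y| *+ 4 <= `|1 - x|.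
Proof.
move=> x1.
have n1 (y z : C) : y ^+ 2 = z -> `|z| = 1 -> `|y| = 1.
  by move=> <- /eqP; rewrite normrX pexpr_eq1// => /eqP.
have [y1 y1E le1] := sqrt_near1 x1.
have [y2 y2E le2] := sqrt_near1 (n1 _ _ y1E x1).
have [y3 y3E le3] := sqrt_near1 (n1 _ _ y2E (n1 _ _ y1E x1)).
have [y4 y4E le4] := sqrt_near1 (n1 _ _ y3E (n1 _ _ y2E (n1 _ _ y1E x1))).
exists y4; first by rewrite -y1E -y2E -y3E -y4E -!exprM.
rewrite -(@ler_pXn2r _ 2) ?nnegrE ?mulrn_wge0//.
rewrite (_ : _ ^+ 2 = `|1 - y4| ^+ 2 *+ 16); last by ring.
apply: le_trans le1; rewrite -[leLHS]/(_ *+ (8 * 2)) mulrnA ler_pMn2r//.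
apply: le_trans le2; rewrite -[leLHS]/(_ *+ (4 * 2)) mulrnA ler_pMn2r//.
apply: le_trans le3; rewrite -[leLHS]/(_ *+ (2 * 2)) mulrnA ler_pMn2r//.
Qed.

Lemma root_chain (C : numClosedFieldType) : exists w : nat -> C,
  [/\ w 0%N = -1, forall k, w k.+1 ^+ 16 = w k, forall k, `|w k| = 1
    & forall k, `|1 - w k| <= 2 / 4 ^+ k].
Proof.
have /choice[s sP] : forall x : C, exists y, `|x| = 1 ->
    y ^+ 16 = x /\ `|1 - y| *+ 4 <= `|1 - x|.
  move=> x; have [x1|x1] := eqVneq `|x| 1; last first.
    by exists 0 => /eqP; rewrite (negPf x1).
  by have [y ? ?] := root16_near1 x1; exists y.
have w1 k : `|iter k s (-1)| = 1.
  elim: k => [|k IH] /=; first by rewrite normrN1.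
  have [/(congr1 Num.norm)/eqP] := sP _ IH.
  by rewrite IH normrX pexpr_eq1// => /eqP.
exists (fun k => iter k s (-1)); split=> // k.
  by have [] := sP _ (w1 k).
elim: k => [|k IH] /=.
  by rewrite opprK expr0 divr1 (_ : 1 + 1 = 2%:R :> C)// normr_nat.
have [_ le4] := sP _ (w1 k).
rewrite exprSr invfM mulrA ler_pdivlMr// mulr_natr.
exact: le_trans le4 IH.
Qed.

(** * Coefficient estimate for lacunary polynomials *)

Section LacunaryEstimate.
Variables (C : numClosedFieldType) (w : nat -> C).
Hypotheses (w0 : w 0%N = -1) (wS : forall k, w k.+1 ^+ 16 = w k).
Hypothesis w_near1 : forall k, `|1 - w k| <= 2 / 4 ^+ k.

Definition lacunary N (c : nat -> C) (x : C) := \sum_(k < N) c k * x ^+ (16 ^ k).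

(** As [w k] is a 16^k-th root of -1, replacing b by b [w k] keeps the terms of index above k and
    flips the sign of the k-th one. *)
Lemma root_chainX k i : w k ^+ (16 ^ i) = if (i <= k)%N then w (k - i) else 1.
Proof.
elim: i k => [|i IH] k; first by rewrite subn0.
rewrite expnS exprM; case: k => [|k]; last by rewrite wS IH.
by rewrite w0 (_ : (-1) ^+ 16 = 1 :> C) ?expr1n// -signr_odd.
Qed.

(** Strong induction on k. The threshold [k0] allows for points b [w k] of small index that fall
    outside Omega: the first [k0] coefficients are then bounded by other means. *)
Lemma lacunary_coef_le k0 N c b T :
  (forall k, (k0 <= k)%N -> `|lacunary N c b - lacunary N c (b * w k)| <= 2 * T) ->
  (forall k, (k < k0)%N -> (k < N)%N -> `|c k| * `|b| ^+ (16 ^ k) <= 2 * T) ->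
  forall k, (k < N)%N -> `|c k| * `|b| ^+ (16 ^ k) <= 2 * T.
Proof.
move=> pT cT k; elim/ltn_ind: k => k IH kN.
have [kk0|k0k] := ltnP k k0; first exact: cT.
have T0 : 0 <= 2 * T by apply: le_trans (pT _ k0k).
have pE : lacunary N c b - lacunary N c (b * w k) =
    \sum_(i < k) (c i * b ^+ (16 ^ i)) * (1 - w (k - i)) + 2 * (c k * b ^+ (16 ^ k)).
  rewrite /lacunary -sumrB (eq_bigr (fun i : 'I_N => (c i * b ^+ (16 ^ i)) *
      (1 - w k ^+ (16 ^ i)))); last first.
    by move=> i _; rewrite exprMn; ring.
  rewrite -(big_mkord xpredT (fun i => (c i * b ^+ (16 ^ i)) * (1 - w k ^+ (16 ^ i)))).
  rewrite (big_cat_nat (n := k.+1))//= [X in _ + X]big1_seq ?addr0.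
    rewrite big_nat_recr//= big_mkord root_chainX leqnn subnn w0 opprK.
    congr (_ + _); last by ring.
    by apply: eq_bigr => i _; rewrite root_chainX ltnW.
  move=> i; rewrite mem_index_iota => /andP[_ /andP[ki _]].
  by rewrite root_chainX leqNgt ki subrr mulr0.
have rec : 2 * (`|c k| * `|b| ^+ (16 ^ k)) <=
    2 * T + \sum_(i < k) (2 * T) * (2 / 4 ^+ (k - i)).
  rewrite -normrX -normrM -[X in X * `|_|](normr_nat C 2) -normrM.
  rewrite -[_ * (c k * _)](addKr (\sum_(i < k) (c i * b ^+ (16 ^ i)) * (1 - w (k - i)))).
  rewrite -pE addrC (le_trans (ler_normD _ _))// normrN lerD ?pT//.
  apply: le_trans (ler_norm_sum _ _ _) _; apply: ler_sum => i _.
  rewrite !normrM normrX ler_pM ?mulr_ge0 ?exprn_ge0// IH//.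
  exact: ltn_trans kN.
(* The lower terms contribute at most 2/3 of 2 T, and 1 + 2/3 <= 2, so the induction closes with the
   same constant. *)
have geo n : \sum_(i < n) 2 / 4 ^+ (n - i) <= 2 / 3 :> C.
  suff : 3 * \sum_(i < n) 2 / 4 ^+ (n - i) = 2 - 2 / 4 ^+ n :> C.
    move=> E; rewrite ler_pdivlMr// mulrC E gerBl divr_ge0// exprn_ge0//.
  elim: n => [|n IHn]; first by rewrite big_ord0 expr0 divr1 subrr mulr0.
  rewrite big_ord_recl subn0 mulrDr.
  under eq_bigr do rewrite lift0 subSS.
  by rewrite IHn exprSr; field; rewrite expf_neq0// pnatr_eq0.
rewrite -(@ler_pM2l _ 2)//; apply: le_trans rec _.
rewrite -mulr_sumr -{1}[2 * T]mulr1 -mulrDr mulrC ler_wpM2r//.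
by apply: le_trans (lerD (lexx _) (geo k)) _;
  rewrite -lerBrDl (_ : 2 - 1 = 1) ?ler_pdivrMr ?mul1r ?ler_nat//; ring.
Qed.

End LacunaryEstimate.

(** * Compactness of convergent sequences; Bernoulli's inequality *)

Lemma compact_cvg_range (T : topologicalType) (x : nat -> T) (l : T) :
  x @ \oo --> l -> compact (range x `|` [set l]).
Proof.
move=> xl F PF FA; apply: contrapT => nF.
have [V [B [Vl FB VB]]] : exists V B, [/\ nbhs l V, F B & V `&` B = set0].
  apply: contrapT => nVB; apply: nF; exists l; split; first by right.
  move=> B V FB Vl; apply/set0P/negP => /eqP BV.
  by apply: nVB; exists V, B; rewrite setIC.
have [n _ nV] := xl V Vl.
(* Off a neighbourhood of l only finitely many terms remain, so the filter lives on a finite, hence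
   compact, set. *)
have /finite_compact/(_ F PF)[] : finite_set (x @` `I_n).
  by apply: finite_image; exact: finite_II.
  apply: filterS (filterI FA FB) => y [[[k _ <-]|->] By].
    have [kn|nk] := ltnP k n; first by exists k.
    suff : set0 (x k) by [].
    by rewrite -VB; split => //; exact: nV.
  suff : set0 l by [].
  by rewrite -VB; split => //; exact: nbhs_singleton.
by move=> y [[k _ <-] clk]; apply: nF; exists (x k); split => //; left; exists k.
Qed.

Lemma bernoulli_le (C : numDomainType) (t : C) n : 0 <= t -> n%:R * t <= (1 + t) ^+ n.
Proof.
move=> t0; suff : 1 + n%:R * t <= (1 + t) ^+ n.
  by apply: le_trans; rewrite lerDr.
elim: n => [|n IH]; first by rewrite mul0r addr0.
rewrite exprSr; apply: le_trans (ler_wpM2r _ IH); last by rewrite addr_ge0.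
rewrite -subr_ge0 (_ : _ - _ = n%:R * t * t); first by rewrite !mulr_ge0.
by rewrite -natr1; ring.
Qed.

(** * Points of Omega and the closed span of the lacunary powers *)

Section Plane.
Context {R : realType}.

Lemma complex_archi (x : R[i]) : exists n : nat, `|x| < n%:R.
Proof.
exists (Num.truncn (complex.Re `|x|)).+1.
rewrite -[ltLHS]RRe_real ?ger0_real//.
by rewrite -(rmorph_nat (real_complex R)) ltcR truncnS_gt.
Qed.

Lemma root_chain_cvg (w : nat -> R[i]) :
  (forall k, `|1 - w k| <= 2 / 4 ^+ k) -> w @ \oo --> (1 : R[i]).
Proof.
move=> w1; apply/cvgrPdist_lt => e e0.
have [n nP] := complex_archi (2 / e); exists n => //= k /= nk.
apply: le_lt_trans (w1 k) _.
rewrite ltr_pdivrMr ?exprn_gt0// mulrC -ltr_pdivrMr//.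
have : 0 <= 2 / e by rewrite divr_ge0// ltW.
move=> /ger0_norm eE; rewrite -eE; apply: lt_le_trans nP _.
rewrite -natrX ler_nat (leq_trans nk)// ltnW// ltn_expl//.
Qed.

Variables (Omega : set R[i]) (z0 : Omega).
Hypothesis Omega_open : open Omega.

(* points outside Omega are sent to the junk value z0 *)
Definition pt (x : R[i]) : Omega := insubd z0 x.

Lemma val_pt x : Omega x -> val (pt x) = x.
Proof. by move=> Ox; rewrite val_insubd mem_set. Qed.

Lemma cvg_pt (x : nat -> R[i]) (l : R[i]) : Omega l -> x @ \oo --> l ->
  (fun k => pt (x k)) @ \oo --> pt l.
Proof.
move=> Ol xl A [_ [[B oB <-] /= Bl BA]].
have lE := val_pt Ol.
have BO : nbhs l (B `&` Omega).
  apply: (@open_nbhs_nbhs R[i]); split; first exact: (openI oB Omega_open).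
  by split=> //; rewrite -lE.
have [n n0 nP] := xl _ BO; exists n => // k /= /nP [Bk Ok].
by apply: BA; rewrite /preimage /= -[set_val _]/(val _) val_pt.
Qed.

(** For holomorphic [phi] this is membership in the space E, the closure being spelled out as
    uniform approximation on compact sets. *)
Definition lacunary_limit (phi : Omega -> R[i]) := forall K : set Omega, compact K ->
  forall e : R[i], 0 < e -> exists N c, forall z, K z ->
    `|phi z - lacunary N c (val z - val z0)| < e.

Lemma lacunary_limit_monomial k :
  lacunary_limit (fun z => (val z - val z0) ^+ (16 ^ k)).
Proof.
move=> K _ e e0; exists k.+1, (fun i => (i == k)%:R) => z _.
rewrite /lacunary big_ord_recr/= eqxx mul1r big1 ?add0r ?subrr ?normr0// => i _.
by rewrite ltn_eqF ?mul0r.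
Qed.

Lemma lacunary_limitZD a phi psi : lacunary_limit phi -> lacunary_limit psi ->
  lacunary_limit (fun z => a * phi z + psi z).
Proof.
move=> hphi hpsi K cK e e0.
have a0 : 0 < `|a| + 1 by rewrite ltr_wpDl.
have e2 : 0 < e / 2 by rewrite divr_gt0.
have [N [c cP]] := hphi K cK _ (divr_gt0 e2 a0).
have [M [d dP]] := hpsi K cK _ e2.
(* Padding with zeros gives the two approximants a common length. *)
pose pad n (f : nat -> R[i]) (k : nat) := if (k < n)%N then f k else 0.
have padE n f n' x : (n <= n')%N -> lacunary n f x = lacunary n' (pad n f) x.
  move=> nn'; rewrite /lacunary (big_ord_widen n' (fun k => f k * x ^+ (16 ^ k)))//.
  rewrite big_mkcond; apply: eq_bigr => i _; rewrite /pad.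
  by case: ifP => // _; rewrite mul0r.
exists (maxn N M), (fun k => a * pad N c k + pad M d k) => z Kz.
set x := val z - val z0.
have -> : lacunary (maxn N M) (fun k => a * pad N c k + pad M d k) x =
    a * lacunary N c x + lacunary M d x.
  rewrite (padE N _ (maxn N M)) ?leq_maxl// (padE M _ (maxn N M)) ?leq_maxr//.
  rewrite /lacunary mulr_sumr -big_split; apply: eq_bigr => i _.
  by rewrite mulrDl mulrA.
rewrite opprD addrACA -mulrBr (splitr e) (le_lt_trans (ler_normD _ _))//.
rewrite ler_ltD ?dP// normrM mulrC.
have := ltW (cP z Kz); rewrite -/x => /ler_pM -/(_ _ _ (normr_ge0 _) (normr_ge0 a)).
move=> /(_ (`|a| + 1)); rewrite lerDl ler01 => /(_ isT).
by rewrite divfK ?gt_eqF.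
Qed.

Lemma lacunary_limit_closed : closed [set phi : holFun Omega | lacunary_limit phi].
Proof.
move=> phi cl K cK e e0.
have e2 : 0 < e / 2 by rewrite divr_gt0.
have [psi [hpsi pp]] := cl _ (nbhs_holFun phi cK e2).
have [N [c cP]] := hpsi K cK _ e2.
exists N, c => z Kz; rewrite -(subrKA (psi z)) (splitr e).
by rewrite (le_lt_trans (ler_normD _ _))// ltrD ?pp ?cP.
Qed.

End Plane.

(** * Elements of E are determined by their values at the nodes *)

Section Uniqueness.
Context {R : realType}.
Variables (Omega : set R[i]) (z0 : Omega) (w : nat -> R[i]) (r : R[i]).
Hypotheses (Omega_open : open Omega) (r0 : 0 < r)
  (disc_Omega : forall x, `|x - val z0| <= r -> Omega x).
Hypotheses (w0 : w 0%N = -1) (wS : forall k, w k.+1 ^+ 16 = w k)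
  (w1 : forall k, `|w k| = 1) (w_near1 : forall k, `|1 - w k| <= 2 / 4 ^+ k).

Let C0 := val z0.

Let addC0K x : C0 + x - C0 = x.
Proof. by rewrite addrC addKr. Qed.

Definition node (j : nat) : Omega :=
  pt z0 (C0 + r * (if j is k.+1 then w k else 1)).

Lemma val_node j : val (node j) = C0 + r * (if j is k.+1 then w k else 1).
Proof.
rewrite val_pt//; apply: disc_Omega; rewrite addC0K normrM gtr0_norm//.
by case: j => [|k]; rewrite ?w1 ?normr1 mulr1.
Qed.

(** When C0 + b is in Omega, only finitely many points of the sequence miss Omega; [pt] sends them
    to z0, and the set is compact. *)
Definition arc (b : R[i]) := range (fun k => pt z0 (C0 + b * w k)) `|` [set pt z0 (C0 + b)].

Lemma arc_cvg b : (fun k => C0 + b * w k) @ \oo --> C0 + b.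
Proof.
rewrite -[X in _ --> _ + X]mulr1; apply: cvgD; first exact: cvg_cst.
by apply: cvgM; [exact: cvg_cst|exact: root_chain_cvg].
Qed.

Lemma arc_compact b : Omega (C0 + b) -> compact (arc b).
Proof.
by move=> Ob; apply: compact_cvg_range; apply: cvg_pt => //; exact: arc_cvg.
Qed.

Lemma near_arc b : Omega (C0 + b) ->
  exists k0, forall k, (k0 <= k)%N -> Omega (C0 + b * w k).
Proof.
move=> Ob.
have [n _ nP] := @arc_cvg b Omega (open_nbhs_nbhs (conj Omega_open Ob)).
by exists n => k; exact: nP.
Qed.

(** On the circle of radius r all test points lie in Omega, so the estimate starts at index 0. *)
Lemma coef_node_le N c e :
  (forall j, `|lacunary N c (val (node j) - C0)| < e) ->
  forall k, (k < N)%N -> `|c k| * r ^+ (16 ^ k) <= 2 * e.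
Proof.
move=> pe k kN; rewrite -[X in _ * X ^+ _](gtr0_norm r0).
apply: (lacunary_coef_le w0 wS w_near1 (k0 := 0)) kN => // {}k _.
have := pe 0%N; have := pe k.+1; rewrite !val_node mulr1 !addC0K.
move=> /ltW p1 /ltW p2; rewrite (le_trans (ler_normB _ _))//.
by rewrite mulr_natl mulr2n lerD.
Qed.

(** z is pushed radially outwards inside a ball contained in Omega; the gain 1 + t in modulus will
    make the series at z decay. At the centre b = r will do. *)
Lemma outer_point (z : Omega) : exists t b : R[i],
  [/\ 0 < t, Omega (C0 + b), b != 0 & `|val z - C0| * (1 + t) <= `|b|].
Proof.
have [zC|zC] := eqVneq (val z - C0) 0.
  exists 1, r; split; rewrite ?gt_eqF//; last by rewrite zC normr0 mul0r normr_ge0.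
  by apply: disc_Omega; rewrite addC0K gtr0_norm.
have zO : Omega (val z) by exact: set_valP.
have /nbhs_ballP[e /= e0 eO] := open_nbhs_nbhs (conj Omega_open zO).
have n0 : 0 < `|val z - C0| by rewrite normr_gt0.
pose t := e / 2 / `|val z - C0|.
have t0 : 0 < t by rewrite !divr_gt0.
have t1 : 0 < 1 + t by rewrite addr_gt0.
exists t, ((val z - C0) * (1 + t)); split=> //.
- apply: eO; rewrite -ball_normE /=.
  rewrite opprD addrA mulrDr mulr1 opprD addrA subrr add0r.
  rewrite normrN normrM (gtr0_norm t0) mulrC divfK ?gt_eqF//.
  by rewrite ltr_pdivrMr// mulr_natr mulr2n ltrDl.
- by rewrite mulf_neq0// gt_eqF.
- by rewrite normrM (gtr0_norm t1).
Qed.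

Lemma sum_half_le N : \sum_(k < N) 1 / 2 ^+ k.+1 <= 1 :> R[i].
Proof.
suff -> : \sum_(k < N) 1 / 2 ^+ k.+1 = 1 - 1 / 2 ^+ N :> R[i].
  by rewrite gerBl divr_ge0// exprn_ge0.
elim: N => [|n IH]; first by rewrite big_ord0 expr0 divr1 subrr.
by rewrite big_ord_recr/= IH exprS; field; rewrite expf_neq0// pnatr_eq0.
Qed.

(* For an approximant close to phi, the values on the nodes make any finite
   number of coefficients small, while the bound at the outer point b is uniform
   and makes the tail of the series at z small. *)
Lemma lacunary_limit_eq0 (phi : holFun Omega) : lacunary_limit z0 phi ->
  (forall j, phi (node j) = 0) -> phi = 0.
Proof.
move=> hphi phi0; apply/val_inj/funext => z.
suff small e : 0 < e -> e <= 1 -> `|phi z| <= 2 * e.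
  apply/eqP; rewrite -normr_le0; apply/ler_addgt0Pl => e e0.
  rewrite addr0.
  (* The number e / (2 + e) is at most 1 and its double is at most e. *)
  have m0 : 0 < e / (2 + e) by rewrite divr_gt0 ?addr_gt0.
  have m1 : e / (2 + e) <= 1 by rewrite ler_pdivrMr ?mul1r ?lerDr// addr_gt0.
  apply: le_trans (small _ m0 m1) _.
  rewrite mulrCA ler_piMr ?(ltW e0)// ler_pdivrMr ?mul1r ?addr_gt0//.
  by rewrite lerDl ltW.
move=> e0 e1.
have [t [b [t0 Ob b0 zb]]] := outer_point z.
have [k0 k0P] := near_arc Ob.
have [S S0 SP] := holFun_bounded phi (arc_compact Ob).
pose nb : R[i] := `|b|.
have nb0 : 0 < nb by rewrite normr_gt0.
(* [S + 1] will bound the approximant on [arc b]; the sum covers the indices below [k0], whose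
   coefficients are bounded at radius r and rescaled to |b|. [T] does not depend on the
   approximant. *)
pose T := S + 1 + \sum_(k < k0) (nb / r) ^+ (16 ^ k).
have sT : 0 <= \sum_(k < k0) (nb / r) ^+ (16 ^ k).
  by apply: sumr_ge0 => k _; rewrite exprn_ge0// divr_ge0// ltW.
have T0 : 0 < T by rewrite /T ltr_wpDr// addr_gt0.
(* For k >= L this yields 8^k e t >= 4 T, which makes the terms at z at most e / 2^(k+1). *)
have [L LP] := complex_archi (4 * T / (e * t)).
pose v : R[i] := `|val z - C0|.
have v0 : 0 <= v by rewrite normr_ge0.
pose D := 1 + \sum_(k < L) (v / r) ^+ (16 ^ k).
have sD : 0 <= \sum_(k < L) (v / r) ^+ (16 ^ k).
  by apply: sumr_ge0 => k _; rewrite exprn_ge0// divr_ge0// ltW.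
have D1 : 1 <= D by rewrite lerDl.
have D0 : 0 < D by apply: lt_le_trans D1.
(* Chosen after [L], so that 2 d D = e / 2^L bounds each of the first [L] terms at z. *)
pose d := e / (2 ^+ L.+1 * D).
have d0 : 0 < d by rewrite divr_gt0// mulr_gt0// exprn_gt0.
have d1 : d <= 1.
  rewrite ler_pdivrMr ?mulr_gt0 ?exprn_gt0// mul1r (le_trans e1)//.
  by rewrite mulr_ege1// exprn_ege1// ler1n.
have de : d <= e.
  rewrite ler_pdivrMr ?mulr_gt0 ?exprn_gt0// ler_peMr ?(ltW e0)//.
  by rewrite mulr_ege1// exprn_ege1// ler1n.
have Or : Omega (C0 + r) by apply: disc_Omega; rewrite addC0K gtr0_norm.
have cK : compact ([set z] `|` (arc b `|` arc r)).
  apply: compactU; first exact: compact_set1.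
  by apply: compactU; exact: arc_compact.
have [N [c cP]] := hphi _ cK _ d0.
have cr k : (k < N)%N -> `|c k| * r ^+ (16 ^ k) <= 2 * d.
  apply: coef_node_le => j; have := cP (node j).
  rewrite phi0 sub0r normrN; apply; right; right.
  by case: j => [|j]; [right; rewrite /node mulr1|left; exists j].
have pS x : arc b x -> `|lacunary N c (val x - C0)| <= S + 1.
  move=> bx; rewrite -[lacunary _ _ _](subKr (phi x)).
  rewrite (le_trans (ler_normB _ _))// lerD ?(ltW (SP _ bx))//.
  by apply: le_trans d1; apply/ltW/cP; right; left.
have cb k : (k < N)%N -> `|c k| * nb ^+ (16 ^ k) <= 2 * T.
  apply: (lacunary_coef_le w0 wS w_near1 (k0 := k0)) => {}k.
    move=> kk0; have := pS (pt z0 (C0 + b * w k)); rewrite (val_pt z0 (k0P k kk0)).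
    have := pS (pt z0 (C0 + b)); rewrite val_pt// !addC0K.
    move=> p1 p2; rewrite (le_trans (ler_normB _ _))// mulr_natl mulr2n.
    apply: lerD; [apply: (le_trans (p1 _))|apply: (le_trans (p2 _))].
    + by right.
    + by rewrite lerDl.
    + by left; exists k.
    + by rewrite lerDl.
  move=> kk0 kN.
  have -> : nb ^+ (16 ^ k) = r ^+ (16 ^ k) * (nb / r) ^+ (16 ^ k).
    by rewrite -exprMn mulrC divfK ?gt_eqF.
  rewrite mulrA ler_pM ?mulr_ge0 ?exprn_ge0 ?divr_ge0 ?(ltW r0) ?(ltW nb0)//.
    by rewrite (le_trans (cr k kN))// ler_piMr.
  rewrite /T (bigD1 (Ordinal kk0))//= addrCA lerDl !addr_ge0 ?(ltW S0)//.
  by apply: sumr_ge0 => i _; rewrite exprn_ge0// divr_ge0// ltW.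
have cz k : (k < N)%N -> `|c k| * v ^+ (16 ^ k) <= e / 2 ^+ k.+1.
  move=> kN; have [kL|Lk] := ltnP k L.
    have -> : v ^+ (16 ^ k) = r ^+ (16 ^ k) * (v / r) ^+ (16 ^ k).
      by rewrite -exprMn mulrC divfK ?gt_eqF.
    have vD : (v / r) ^+ (16 ^ k) <= D.
      rewrite /D (bigD1 (Ordinal kL))//= addrCA lerDl addr_ge0//.
      by apply: sumr_ge0 => i _; rewrite exprn_ge0// divr_ge0// ltW.
    rewrite mulrA; apply: (@le_trans _ _ (2 * d * D)).
      by rewrite ler_pM ?mulr_ge0 ?exprn_ge0 ?divr_ge0 ?cr// ltW.
    have -> : 2 * d * D = e / 2 ^+ L.
      by rewrite /d exprS; field; rewrite expf_neq0 ?pnatr_eq0// gt_eqF.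
    rewrite ler_pM2l// lef_pV2 ?posrE ?exprn_gt0//.
    by rewrite ler_eXn2l// ltr1n.
  (* By Bernoulli, 16^k t v^(16^k) <= (v (1 + t))^(16^k) <= |b|^(16^k). In 16^k = 8^k 2^k the first
     factor absorbs the constants, the second gives summability. *)
  have tk : 0 < (16 ^ k)%:R * t :> R[i] by rewrite mulr_gt0// ltr0n expn_gt0.
  rewrite -(ler_pM2r tk).
  apply: (@le_trans _ _ (`|c k| * nb ^+ (16 ^ k))).
    rewrite -mulrA ler_wpM2l//.
    apply: le_trans (ler_wpM2l _ (bernoulli_le _ (ltW t0))) _.
      by rewrite exprn_ge0.
    by rewrite -exprMn lerXn2r ?nnegrE ?mulr_ge0 ?addr_ge0// ltW.
  apply: le_trans (cb k kN) _.
  have -> : e / 2 ^+ k.+1 * ((16 ^ k)%:R * t) = (8 ^ k)%:R * (e * t) / 2.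
    rewrite (_ : 16 ^ k = 8 ^ k * 2 ^ k)%N; last by rewrite -expnMn.
    rewrite natrM exprS (natrX _ 2).
    by field; rewrite expf_neq0 ?pnatr_eq0.
  rewrite ler_pdivlMr// (_ : 2 * T * 2 = 4 * T); last by ring.
  rewrite -ler_pdivrMr ?mulr_gt0//.
  have q0 : 0 <= 4 * T / (e * t) by rewrite divr_ge0 ?mulr_ge0// ltW// mulr_gt0.
  rewrite -(ger0_norm q0) (le_trans (ltW LP))// ler_nat (leq_trans Lk)//.
  by rewrite ltnW// ltn_expl.
rewrite -[phi z](subrK (lacunary N c (val z - C0))) mulr_natl mulr2n.
apply: le_trans (ler_normD _ _) _; apply: lerD.
  by apply: le_trans de; apply/ltW/cP; left.
apply: (@le_trans _ _ (\sum_(k < N) e * (1 / 2 ^+ k.+1))); last first.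
  by rewrite -mulr_sumr ler_piMr ?sum_half_le ?(ltW e0).
apply: le_trans (ler_norm_sum _ _ _) _; apply: ler_sum => k _.
by rewrite normrM normrX mulrA mulr1 cz.
Qed.

End Uniqueness.

(** * Distribution of the bad indices *)

Lemma infinite_fibres (B : nat -> Prop) : (forall N, exists2 n, (N <= n)%N & B n) ->
  exists g : nat -> nat, forall j N, exists n, [/\ (N <= n)%N, B n & g n = j].
Proof.
move=> exB; have /choice[s sP] N : exists n, (N <= n)%N /\ B n.
  by have [n] := exB N; exists n.
have sN N : (N <= s N)%N by have [] := sP N.
pose t k := iter k (fun n => s n.+1) (s 0%N).
have tB k : B (t k) by case: k => [|k]; [case: (sP 0%N)|case: (sP (t k).+1)].
have tlt k : (t k < t k.+1)%N by exact: sN.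
have tmono : {mono t : x y / (x <= y)%N} by exact/leq_mono/(homo_ltn ltn_trans tlt).
have tinj : injective t by move=> x y /eqP; rewrite eqn_leq !tmono -eqn_leq => /eqP.
have tk k : (k <= t k)%N by elim: k => // k IH; exact: leq_ltn_trans (tlt k).
(* [h] inverts [t] on its range; its values elsewhere are irrelevant. *)
have /choice[h hP] : forall n, exists k, (exists k', t k' = n) -> t k = n.
  move=> n; have [[k kn]|nk] := pselect (exists k, t k = n); first by exists k.
  by exists 0%N => /nk.
(* Along the strictly increasing sequence [t] in B, this is the 2-adic valuation of k + 1, which
   takes every value infinitely often. *)
exists (fun n => logn 2 (h n).+1) => j N.
have k0 : (0 < 2 ^ j * N.*2.+1)%N by rewrite muln_gt0 expn_gt0.
(* 2^j (2 N + 1) has valuation j, and its predecessor is at least N. *)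
exists (t (2 ^ j * N.*2.+1).-1); split=> //.
  apply: leq_trans (tk _); rewrite -ltnS prednK//.
  apply: (@leq_trans N.*2.+1); first by rewrite ltnS -addnn leq_addr.
  by rewrite leq_pmull// expn_gt0.
rewrite (tinj _ _ (hP _ _)); last by exists (2 ^ j * N.*2.+1).-1.
rewrite prednK// lognM ?expn_gt0// pfactorK//.
by rewrite lognE dvdn2 /= odd_double /= addn0.
Qed.

(** * Both convergences in epsilon form; monomials in H(Omega) *)

Section Convergence.
Context {R : realType} (Omega : set R[i]).

Lemma cvg_unifP (K : set Omega) (u : nat -> Omega -> R[i]) :
  {uniform K, u @ \oo --> (fun=> 0)} <->
  forall e, 0 < e -> \forall n \near \oo, forall z, K z -> `|u n z| < e.
Proof.
split=> [uK e e0|uK P].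
  apply: (uK [set g : Omega -> R[i] | forall z, K z -> `|g z| < e]).
  apply/uniform_nbhs; exists [set xy | ball xy.1 e xy.2]; split.
    exact: entourage_ball (PosNum e0).
  by move=> g /= Kg z /Kg; rewrite -ball_normE /= sub0r normrN.
move=> /uniform_nbhs[E [entE EP]].
move: entE; rewrite -entourage_ballE => -[e /= e0 eE].
have := uK e e0; apply: filterS => g Kg.
apply: EP => z Kz; apply: eE => /=; rewrite -ball_normE /= sub0r normrN; exact: Kg.
Qed.

Lemma S_ucP (u : holSeq Omega) : S_uc Omega u <-> forall K, compact K ->
  forall e, 0 < e -> \forall n \near \oo, forall z, K z -> `|u n z| < e.
Proof. by split=> uK K /uK/cvg_unifP. Qed.

Lemma S_uP (u : holSeq Omega) : S_u Omega u <->
  forall e, 0 < e -> \forall n \near \oo, forall z, `|u n z| < e.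
Proof.
split=> [/cvg_unifP uT e /uT|uT].
  by apply: filterS => n un z; exact: un.
by apply/cvg_unifP => e /uT; apply: filterS => n un z _; exact: un.
Qed.

Lemma not_S_uP (u : holSeq Omega) : ~ S_u Omega u ->
  exists2 e, 0 < e & forall N, exists2 n, (N <= n)%N & exists z, e <= `|u n z|.
Proof.
move=> nu; apply: contrapT => ne; apply/nu/S_uP => e e0.
apply: contrapT => nn; apply: ne; exists e => // N.
apply: contrapT => nN; apply: nn; exists N => // n /= Nn z.
have [//|ez] := real_ltP (normr_real (u n z)) (gtr0_real e0).
by exfalso; apply: nN; exists n => //; exists z.
Qed.

Hypothesis Omega_open : open Omega.

(** Near a point of the open set Omega the extension by zero coincides with the polynomial on the
    plane, and derivability is local. *)
Lemma holomorphic_monomial (z0 : Omega) m :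
  (fun z : Omega => (val z - val z0) ^+ m) \in @holomorphic_pred R Omega.
Proof.
apply/mem_set => z; set f := fun z : Omega => _.
have fE x : Omega x -> (x - val z0) ^+ m = 'valL_0 f x.
  move=> Ox; rewrite -(val_pt z Ox).
  by rewrite -[LHS]/(f (pt z x)) -[in LHS](valLK 0 f).
have zO : Omega (val z) by exact: set_valP.
apply: (@near_eq_derivable _ R[i] R[i] ((id - cst (val z0)) ^+ m)).
  apply: filterS (open_nbhs_nbhs (conj Omega_open zO)) => x /fE <-.
  by rewrite exprfctE.
by apply: derivableX; apply: derivableB; [exact: derivable_id|exact: derivable_cst].
Qed.

Definition monomial (z0 : Omega) m : holFun Omega := HolFun (holomorphic_monomial z0 m).

End Convergence.

(** * Continuity of scalar and vector operations on functions *)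

Section AbstractContinuity.
Context {K : numFieldType} {T : topologicalType}.

Lemma continuous_addf (F G : T -> K) :
  continuous F -> continuous G -> continuous (fun x => F x + G x).
Proof. by move=> cF cG x; apply: cvgD; [exact: cF|exact: cG]. Qed.

Lemma continuous_subf (F G : T -> K) :
  continuous F -> continuous G -> continuous (fun x => F x - G x).
Proof. by move=> cF cG x; apply: cvgB; [exact: cF|exact: cG]. Qed.

Lemma continuous_mulr (F : T -> K) c : continuous F -> continuous (fun x => F x * c).
Proof. by move=> cF x; apply: cvgM; [exact: cF|exact: cvg_cst]. Qed.

Lemma closed_zeros (F : T -> K) : continuous F -> closed [set x | F x = 0].
Proof.
move=> cF; rewrite (_ : [set x | _] = F @^-1` [set 0])//.
apply: closed_comp => [x _|]; first exact: cF.
exact/accessible_closed_set1/hausdorff_accessible/norm_hausdorff.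
Qed.

Lemma continuous_comp_fun (U V : topologicalType) (F : T -> U) (G : U -> V) :
  continuous F -> continuous G -> continuous (fun x => G (F x)).
Proof. by move=> cF cG x; apply: continuous_comp; [exact: cF|exact: cG]. Qed.

Lemma continuous_subZ (V : topologicalLmodType K) (F : T -> V) (l : T -> K) (v : V) :
  continuous F -> continuous l -> continuous (fun x => F x - l x *: v).
Proof.
move=> cF cl x.
have cZ (a : T -> K) (G : T -> V) : {for x, continuous a} -> {for x, continuous G} ->
    {for x, continuous (fun y => a y *: G y)}.
  move=> ca cG.
  exact: (cvg_comp _ _ (cvg_pair ca cG) (@scale_continuous K V (a x : K^o, G x))).
rewrite (_ : (fun y => _) = fun y => F y + -1 *: (l y *: v)); last first.
  by apply/funext => y; rewrite scaleN1r.
have c2 : {for x, continuous (fun y => -1 *: (l y *: v))}.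
  apply: (cZ (fun=> -1)); first exact: cvg_cst.
  by apply: cZ; [exact: cl|exact: cvg_cst].
exact: (cvg_comp _ _ (cvg_pair (cF x) c2) (@add_continuous V (F x, -1 *: (l x *: v)))).
Qed.

End AbstractContinuity.

(** * The subspace attached to f *)

Section Construction.
Context {R : realType} (Omega : set R[i]) (z0 : Omega) (w : nat -> R[i]) (r : R[i]).
Hypotheses (Omega_open : open Omega) (r0 : 0 < r)
  (disc_Omega : forall x, `|x - val z0| <= r -> Omega x).
Hypotheses (w0 : w 0%N = -1) (wS : forall k, w k.+1 ^+ 16 = w k)
  (w1 : forall k, `|w k| = 1) (w_near1 : forall k, `|1 - w k| <= 2 / 4 ^+ k).
Variables (f : holSeq Omega) (d : R[i]) (g : nat -> nat) (n1 : nat) (z1 : Omega).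
Hypotheses (d0 : 0 < d)
  (g_bad : forall j N, exists n,
     [/\ (N <= n)%N, exists z, d <= `|f n z| & g n = j])
  (n1_gt0 : (0 < n1)%N) (gn1 : g n1 = 0%N) (fn1 : f n1 z1 != 0).

(** P_n is [point (g n)]; index 0 is reserved for z0, where all of E vanishes. *)
Definition point (j : nat) : Omega := if j is k.+1 then node z0 w r k else z0.

(** Since P_n is z0 at n = [n1], a member of the subspace has u_n1 = lam f_n1, whence the quotient;
    [fun0] then recovers phi. *)
Definition lam (u : holSeq Omega) : R[i] := u n1 z1 / f n1 z1.
Definition fun0 (u : holSeq Omega) : holFun Omega := u 0%N - lam u *: f 0%N.

(** Conditions on the continuous maps [lam] and [fun0], rather than an image of pairs (lam, phi),
    make closedness a matter of preimages. *)
Definition subspace : set (holSeq Omega) := [set u | lacunary_limit z0 (fun0 u) /\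
  forall n z, (0 < n)%N -> u n z = (lam u + fun0 u (point (g n))) * f n z].

Lemma lamZD a u v : lam (a *: u + v) = a * lam u + lam v.
Proof. by rewrite /lam -[(a *: u + v) n1 z1]/(a * u n1 z1 + v n1 z1) mulrDl mulrA. Qed.

Lemma fun0ZD a u v : fun0 (a *: u + v) = a *: fun0 u + fun0 v.
Proof.
rewrite /fun0 lamZD -[(a *: u + v) 0%N]/(a *: u 0%N + v 0%N).
by rewrite scalerDl scalerBr scalerA opprD addrACA.
Qed.

Lemma lam_base : lam f = 1. Proof. by rewrite /lam divff. Qed.

Lemma fun0_base : fun0 f = 0. Proof. by rewrite /fun0 lam_base scale1r subrr. Qed.

Lemma lacunary_limit0 : lacunary_limit z0 (0 : holFun Omega).
Proof.
move=> K _ e e0; exists 0%N, (fun=> 0) => z _.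
by rewrite /lacunary big_ord0 subr0 -[X in `|X|]/0 normr0.
Qed.

(** The exponents 16^k are positive, so every approximant vanishes at z0. *)
Lemma lacunary_limit_center (phi : holFun Omega) : lacunary_limit z0 phi -> phi z0 = 0.
Proof.
move=> hphi; apply/eqP; rewrite -normr_le0; apply/ler_addgt0Pl => e e0.
have [N [c cP]] := hphi _ (@compact_set1 _ z0) e e0.
have := ltW (cP z0 erefl); rewrite addr0 subrr /lacunary big1 ?subr0// => i _.
by rewrite expr0n expn_eq0 mulr0.
Qed.

Lemma subspace_submod : submod_closed [in subspace].
Proof.
split=> [|a u v /set_mem[hu uE] /set_mem[hv vE]]; apply/mem_set.
  have l0 : lam 0 = 0 by rewrite /lam -[(0 : holSeq Omega) n1 z1]/0 mul0r.
  have f0 : fun0 0 = 0 by rewrite /fun0 l0 scale0r subr0.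
  split; first by rewrite f0; exact: lacunary_limit0.
  by move=> n z _; rewrite l0 f0 -[(0 : holFun Omega) _]/0 addr0 mul0r.
split; first by rewrite fun0ZD; exact: lacunary_limitZD.
move=> n z n0; rewrite fun0ZD lamZD -[LHS]/(a * u n z + v n z) uE// vE//.
by rewrite -[(a *: fun0 u + fun0 v) _]/(a * fun0 u _ + fun0 v _); ring.
Qed.

Lemma holFun_eval_continuous (z : Omega) : continuous (fun phi : holFun Omega => phi z : R[i]).
Proof.
move=> phi A /nbhs_ballP[e /= e0 eA].
apply: (@filterS _ (nbhs phi) _ _ _ _ (nbhs_holFun phi (@compact_set1 _ z) e0)).
by move=> psi psiz; apply: eA; rewrite -ball_normE; exact: psiz.
Qed.

Lemma holSeq_eval_continuous n (z : Omega) : continuous (fun u : holSeq Omega => u n z : R[i]).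
Proof.
exact: (continuous_comp_fun (holSeq_proj_continuous (n := n)) (holFun_eval_continuous (z := z))).
Qed.

Lemma lam_continuous : continuous lam.
Proof. exact/continuous_mulr/holSeq_eval_continuous. Qed.

Lemma fun0_continuous : continuous fun0.
Proof.
apply: continuous_subZ; [exact: holSeq_proj_continuous|exact: lam_continuous].
Qed.

Lemma subspace_closed : closed subspace.
Proof.
pose F n z (u : holSeq Omega) : R[i] :=
  u n z - (lam u + fun0 u (point (g n))) * f n z.
have cF n z : continuous (F n z).
  apply: continuous_subf; first exact: holSeq_eval_continuous.
  apply: continuous_mulr; apply: continuous_addf; first exact: lam_continuous.
  exact: (continuous_comp_fun fun0_continuous (holFun_eval_continuous (z := _))).
rewrite (_ : subspace = fun0 @^-1` [set phi | lacunary_limit z0 phi] `&`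
    \bigcap_(n in [set n | (0 < n)%N]) \bigcap_z [set u | F n z u = 0]); last first.
  apply/seteqP; split=> u [hu uE]; split=> //.
    by move=> n /= n0 z _; rewrite /F /= uE// subrr.
  by move=> n z n0; have /eqP := uE n n0 z I; rewrite subr_eq0 => /eqP.
apply: closedI.
  by apply: closed_comp => [u _|]; [exact: fun0_continuous|exact: lacunary_limit_closed].
by apply: closed_bigI => n _; apply: closed_bigI => z _; exact: closed_zeros.
Qed.

Lemma subspace_base : subspace f.
Proof.
split; first by rewrite fun0_base; exact: lacunary_limit0.
by move=> n z _; rewrite lam_base fun0_base -[(0 : holFun Omega) _]/0 addr0 mul1r.
Qed.

(** The member with lam = 0 and phi = (z - z0)^(16^k). *)
Definition basis_seq k : holSeq Omega := fun n =>
  let e := monomial Omega_open z0 (16 ^ k) in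
  if n is 0 then e else e (point (g n)) *: f n.

Lemma subspace_basis k : subspace (basis_seq k).
Proof.
have l0 : lam (basis_seq k) = 0.
  rewrite /lam /basis_seq; case: (n1) n1_gt0 gn1 => // m _ -> /=.
  rewrite -[(_ *: _) z1]/((val z0 - val z0) ^+ (16 ^ k) * f m.+1 z1).
  by rewrite subrr expr0n expn_eq0 !mul0r.
have f0 : fun0 (basis_seq k) = monomial Omega_open z0 (16 ^ k).
  by rewrite /fun0 l0 scale0r subr0.
split; first by rewrite f0; exact: lacunary_limit_monomial.
by move=> [//|n] z _; rewrite l0 f0 add0r.
Qed.

(** In a span of n vectors, n + 1 of the [basis_seq] satisfy a linear relation. Its 0-th term is a
    lacunary polynomial vanishing on Omega, and the estimate at the nodes annihilates its
    coefficients. *)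
Lemma subspace_infinite_dim : ~ finite_dim subspace.
Proof.
move=> [n [v [_ vP]]].
have /choice[c cP] k : exists c : 'I_n -> R[i], basis_seq k = \sum_(i < n) c i *: v i.
  exact/vP/subspace_basis.
pose A : 'M[R[i]]_(n.+1, n) := \matrix_(k, i) c k i.
have [dd dA d_neq0] : exists2 dd : 'rV[R[i]]_n.+1, dd *m A = 0 & dd != 0.
  have : kermx A != 0.
    by rewrite -mxrank_eq0 mxrank_ker subn_eq0 -ltnNge ltnS rank_leq_col.
  move=> /rowV0Pn[dd /sub_kermxP dA d_neq0]; by exists dd.
have sum0 : \sum_(k < n.+1) dd 0 k *: basis_seq k = 0.
  under eq_bigr do rewrite cP scaler_sumr.
  rewrite exchange_big/= big1// => i _.
  under eq_bigr do rewrite scalerA.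
  rewrite -scaler_suml.
  have -> : \sum_(k < n.+1) dd 0 k * c k i = (dd *m A) 0 i.
    by rewrite mxE; apply: eq_bigr => k _; rewrite mxE.
  by rewrite dA mxE scale0r.
pose dn k : R[i] := if insub k is Some i then dd 0 i else 0.
have lac0 (z : Omega) : lacunary n.+1 dn (val z - val z0) = 0.
  have := congr1 (fun u : holSeq Omega => (u 0%N z : R[i])) sum0.
  rewrite -[RHS]/0 => <-.
  rewrite (big_morph (fun u : holSeq Omega => u 0%N z : R[i])
    (id1 := 0) (op1 := +%R))//.
  by apply: eq_bigr => k _; rewrite /dn valK.
have small e k : 0 < e -> (k < n.+1)%N -> `|dn k| * r ^+ (16 ^ k) <= 2 * e.
  move=> e0; apply: (coef_node_le r0 disc_Omega w0 wS w1 w_near1) => j.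
  by rewrite lac0 normr0.
case/negP: d_neq0; apply/eqP/rowP => k; rewrite mxE.
apply/eqP; rewrite -normr_le0; apply/ler_addgt0Pl => e e0; rewrite addr0.
have rk : 0 < r ^+ (16 ^ k) by rewrite exprn_gt0.
have := small (e * r ^+ (16 ^ k) / 2) k _ (ltn_ord k).
rewrite /dn valK mulrCA divff ?pnatr_eq0// mulr1 ler_pM2r//; apply.
by rewrite divr_gt0// mulr_gt0.
Qed.

Lemma subspace_subset : S_uc Omega f -> subspace `<=` (S_uc Omega `\` S_u Omega) `|` [set 0].
Proof.
move=> /S_ucP fuc u [hu uE].
have [u0|u0] := pselect (u = 0); [by right|left; split].
  apply/S_ucP => K cK e e0.
  have Or : Omega (val z0 + r).
    by apply: disc_Omega; rewrite addrC addKr gtr0_norm.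
  have [S S0 SP] := holFun_bounded (fun0 u)
    (compactU (@compact_set1 _ z0) (arc_compact Omega_open w_near1 Or)).
  have C0 : 0 < `|lam u| + S by rewrite ltr_wpDl.
  (* z0 and the nodes lie in one compact set, so the factor lam + phi(P_n) is bounded uniformly in
     n. *)
  have uC n z : (0 < n)%N -> `|u n z| <= (`|lam u| + S) * `|f n z|.
    move=> n0; rewrite uE// normrM ler_wpM2r// (le_trans (ler_normD _ _))//.
    rewrite lerD2l ltW// SP//; case: (g n) => [|[|j]]; first by left.
      by right; right; rewrite /point /node mulr1.
    by right; left; exists j.
  have [N _ NP] := fuc K cK _ (divr_gt0 e0 C0).
  (* The shift skips the 0-th term, which [uC] does not cover. *)
  exists N.+1 => // n /= Nn z Kz; rewrite (le_lt_trans (uC _ _ _))//.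
    exact: leq_ltn_trans Nn.
  by rewrite mulrC -ltr_pdivlMr// NP// /= ltnW.
move=> /S_uP uu; apply: u0.
(* Otherwise sup |u_n| would be at least |lam + phi(P_n)| d > 0 at the infinitely many bad n with g
   n = j. *)
have lam_fun0 j : lam u + fun0 u (point j) = 0.
  apply/eqP; apply: contrapT => /negP lf.
  have e0 : 0 < `|lam u + fun0 u (point j)| * d by rewrite mulr_gt0// normr_gt0.
  have [N _ NP] := uu _ e0.
  have [n [Nn [z fz] gn]] := g_bad j N.+1.
  have := NP n (ltnW Nn) z; rewrite uE; last exact: leq_ltn_trans Nn.
  by rewrite gn normrM ltr_pM2l ?normr_gt0// => /(le_lt_trans fz); rewrite ltxx.
have l0 : lam u = 0.
  by have := lam_fun0 0%N; rewrite lacunary_limit_center// addr0.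
have f0 : fun0 u = 0.
  apply: (lacunary_limit_eq0 Omega_open r0 disc_Omega w0 wS w1 w_near1 hu) => j.
  by have := lam_fun0 j.+1; rewrite l0 add0r.
apply/funext => -[|n].
  by move: f0; rewrite /fun0 l0 scale0r subr0.
apply/val_inj/funext => z; rewrite -[LHS]/(u n.+1 z) uE// l0 f0 add0r.
by rewrite -[(0 : holFun Omega) _]/0 mul0r.
Qed.

End Construction.

Unset Implicit Arguments.

Theorem theorem3p5 (R : realType) (Omega : set R[i]) (Omega_open : open Omega)
    (Omega_neq0 : Omega !=set0) :
  pointwise_spaceable (S_uc Omega `\` S_u Omega).
Proof.
move=> f [fuc /not_S_uP[d d0 /infinite_fibres[g gP]]].
have [x Ox] := Omega_neq0; pose z0 : Omega := SigSub (mem_set Ox).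
have [w [w0 wS w1 w_near1]] := root_chain R[i].
have /nbhs_ballP[e /= e0 eO] := open_nbhs_nbhs (conj Omega_open Ox).
(* Halving the radius puts the closed disc inside the open ball. *)
have r0 : 0 < e / 2 by rewrite divr_gt0.
have disc y : `|y - val z0| <= e / 2 -> Omega y.
  move=> yr; apply: eO; rewrite -ball_normE /= distrC.
  by apply: le_lt_trans yr _; rewrite ltr_pdivrMr// mulr_natr mulr2n ltrDl.
(* A bad index other than 0 assigned to z0, with a point where f_n1 is nonzero: lam is read off
   there. *)
have [n1 [n1_gt0 [z1 fz1] gn1]] := gP 0%N 1%N.
have fn1 : f n1 z1 != 0 by rewrite -normr_gt0 (lt_le_trans d0).
exists (subspace z0 w (e / 2) f g n1 z1); split.
- exact: subspace_submod.
- exact: subspace_closed.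
- exact: subspace_infinite_dim.
- exact: subspace_base.
- exact: (subspace_subset Omega_open r0 disc w0 wS w1 w_near1 d0 gP fuc).
Qed.
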